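(* Let $\ell,d,r,N\in\mathbb{N}$, let $\mathcal{D}$ be a log-concave distribution on $\mathbb{R}$ with a density, and let $\boldsymbol{X}_1,\dots,\boldsymbol{X}_N\sim\mathcal{D}^{\otimes d}$ be i.i.d. random vectors in $\mathbb{R}^d$. Let $C>2\ell^2$ be an arbitrary constant and suppose $N\ge Crd$. Then, with probability one (over $\boldsymbol{X}_1,\dots,\boldsymbol{X}_N$), the following holds simultaneously for all order-$\ell$ tensors $\boldsymbol{\mathcal{T}}^*\in\mathbb{R}^{d\times\cdots\times d}$ with $\mathrm{rank}_S(\boldsymbol{\mathcal{T}}^* )\le r$: setting $Y_i=\langle \boldsymbol{\mathcal{T}}^*,\boldsymbol{X}_i^{\otimes \ell}\rangle$ for $i=1,\dots,N$, the symmetric rank minimization program $$\min_{\boldsymbol{\mathcal{T}}\in\mathbb{R}^{d\times\cdots\times d}}\ \mathrm{rank}_S(\boldsymbol{\mathcal{T}})\quad\text{subject to}\quad \langle\boldsymbol{\mathcal{T}},\boldsymbol{X}_i^{\otimes\ell}\rangle=Y_i,\ i=1,\dots,N,$$ has $\boldsymbol{\mathcal{T}}^*$ as its unique solution.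
   Context: An order-$\ell$ tensor $\boldsymbol{\mathcal{T}}\in\mathbb{R}^{d\times\cdots\times d}$ is an array of real numbers $\boldsymbol{\mathcal{T}}_{i_1,\dots,i_\ell}$, $i_1,\dots,i_\ell\in\{1,\dots,d\}$, and $\langle\cdot,\cdot\rangle$ is the Euclidean inner product on $\mathbb{R}^{d^\ell}$. For $\boldsymbol{v}\in\mathbb{R}^d$, $\boldsymbol{v}^{\otimes\ell}$ is the order-$\ell$ tensor with entries $(\boldsymbol{v}^{\otimes \ell})_{i_1,\dots,i_\ell}=\boldsymbol{v}(i_1)\cdots\boldsymbol{v}(i_\ell)$. The symmetric rank is $\mathrm{rank}_S(\boldsymbol{\mathcal{T}})=\min\{s\ge1:\boldsymbol{\mathcal{T}}=\sum_{i\le s}\lambda_i\boldsymbol{v}_i^{\otimes\ell},\ \lambda_i\in\mathbb{R},\ \boldsymbol{v}_i\in\mathbb{R}^d\}$ (and $+\infty$ if no such decomposition exists). A distribution on $\mathbb{R}$ with density $f$ is log-concave if $-\log f$ is a convex function (with values in $(-\infty,+\infty]$). $\mathcal{D}^{\otimes d}$ is the $d$-fold product measure, i.e. the entries of $\boldsymbol{X}_i$ are i.i.d. samples from $\mathcal{D}$. *)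

(* Defs.v *)
From HB Require Import structures.
From mathcomp Require Import all_boot all_order all_algebra.
From mathcomp Require Import all_classical all_reals all_analysis.

Set Implicit Arguments.
Unset Strict Implicit.
Unset Printing Implicit Defensive.
Import Order.TTheory GRing.Theory Num.Theory.
Import numFieldNormedType.Exports.

Local Open Scope classical_set_scope.
Local Open Scope ring_scope.

(* Vectors of R^d are d-tuples: unlike row vectors, these carry the product
   sigma-algebra in the library. *)

Section tensors.
Variables (R : realType) (l d : nat).

Definition tensor : Type := {ffun l.-tuple 'I_d -> R}.

Definition tensor_dot (S T : tensor) : R := \sum_(I : l.-tuple 'I_d) S I * T I.

Definition tensor_pow (v : d.-tuple R) : tensor :=
  [ffun I : l.-tuple 'I_d => \prod_(k < l) tnth v (tnth I k)].

Definition sym_decomposition (s : nat) (T : tensor) : Prop :=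
  exists (lam : 'I_s -> R) (v : 'I_s -> d.-tuple R),
    forall I, T I = \sum_(i < s) lam i * tensor_pow (v i) I.

(* The infimum of a nonempty set of natural numbers is attained, and the
   infimum of the empty set is +oo. *)
Definition sym_rank (T : tensor) : \bar R :=
  ereal_inf [set s%:R%:E | s in [set s : nat | (1 <= s)%N /\ sym_decomposition s T]].

Definition feasible (N : nat) (x : 'I_N -> d.-tuple R) (Y : 'I_N -> R) :
    set tensor :=
  [set T | forall i, tensor_dot T (tensor_pow (x i)) = Y i].

Definition rank_minimizers (N : nat) (x : 'I_N -> d.-tuple R) (Y : 'I_N -> R) :
    set tensor :=
  [set T | feasible x Y T /\
    forall T', feasible x Y T' -> (sym_rank T <= sym_rank T')%E].

End tensors.

Section distributions.
Variable R : realType.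

Definition econvex (g : R -> \bar R) : Prop :=
  forall (x y t : R), 0 <= t <= 1 ->
    (g (t * x + (1 - t) * y)%R <= t%:E * g x + (1 - t)%:E * g y)%E.

Definition has_density (D : probability R R) (f : R -> R) :
    Prop :=
  [/\ measurable_fun setT f, forall x, 0 <= f x &
      forall A : set R, measurable A ->
        D A = (\int[lebesgue_measure]_(x in A) (f x)%:E)%E].

(* [lne 0 = -oo], so that [- log f] is [+oo] where [f] vanishes. *)
Definition log_concave (D : probability R R) : Prop :=
  exists2 f : R -> R, has_density D f & econvex (fun x => - lne (f x)%:E)%E.

(* [Q] is the d-fold product measure of [D]; rectangles are a generating
   pi-system, so this determines [Q]. *)
Definition is_power_measure (D : probability R R) (d : nat)
    (Q : set (d.-tuple R) -> \bar R) : Prop :=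
  forall B : 'I_d -> set R, (forall j, measurable (B j)) ->
    Q [set x | forall j, B j (tnth x j)] = (\prod_(j < d) D (B j))%E.

(* Subfamilies are covered by taking [A i = setT] for the other indices. *)
Definition mutually_independent d d' (Omega : measurableType d)
    (S : measurableType d') (P : probability Omega R) (N : nat)
    (X : 'I_N -> {RV P >-> S}) : Prop :=
  forall A : 'I_N -> set S, (forall i, measurable (A i)) ->
    P [set w | forall i, A i (X i w)] = (\prod_(i < N) P (X i @^-1` A i))%E.

End distributions.

(* Main.v *)
(* A density makes D atomless, so by Fubini a nonzero polynomial vanishes at the
   Nd independent coordinates x_ij with probability zero; there are countably many
   rational polynomials, hence almost surely the x_ij are algebraically
   independent over Q.

   Two tensors of symmetric rank at most r with the same measurements differ by a
   tensor of rank at most 2r, i.e. by a form whose coefficients are polynomials in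
   2rd real parameters t and which vanishes at the N > 2rd points x_i. If it were
   nonzero, with leading coefficient c(t), then division by it would write
   c(t)^W times each of the n^(Nd) monomials in x of degrees < n as a rational
   combination of monomials in t of degrees O(n) times monomials in x which, at
   each of the N points, are not divisible by the leading one. There are only
   O(n^(2rd + N(d-1))) of these, fewer than n^(Nd) for large n, and linear algebra
   over Q gives a polynomial relation between the x_ij. *)

Require Import Defs.
From HB Require Import structures.
From mathcomp Require Import all_boot all_order all_algebra.
From mathcomp Require Import all_classical all_reals all_analysis.
From mathcomp Require Import measurable_realfun zify ring.

Set Implicit Arguments.
Unset Strict Implicit.
Unset Printing Implicit Defensive.
Import Order.TTheory GRing.Theory Num.Theory.
Import numFieldNormedType.Exports.

Local Open Scope classical_set_scope.
Local Open Scope ring_scope.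

(** There are fewer columns in [S] than rows, so the left kernel is nonzero. Over the rationals this
    supplies the polynomial relation of the dimension count. *)
Lemma linear_dependence (K : fieldType) (E T : finType) (S : {pred T})
    (M : E -> T -> K) :
  (#|S| < #|E|)%N ->
  exists2 y : E -> K, (exists e, y e != 0) &
    forall t, t \in S -> \sum_e y e * M e t = 0.
Proof.
move=> ltSE; pose A := \matrix_(i < #|E|, j < #|S|) M (enum_val i) (enum_val j).
have /rowV0Pn[v /sub_kermxP vA nzv] : kermx A != 0.
  rewrite kermx_eq0 /row_free neq_ltn; apply/orP; left.
  exact: leq_ltn_trans (rank_leq_col A) ltSE.
have [i vi] := rV0Pn _ nzv.
exists (fun e => v 0 (enum_rank e)) => [|t tS].
  by exists (enum_val i); rewrite enum_valK.
have /matrixP/(_ 0 (enum_rank_in tS t)) := vA.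
rewrite !mxE; apply: etrans; rewrite (reindex (@enum_val E xpredT)) /=; last first.
  exact: onW_bij (@enum_val_bij E).
by apply: eq_bigr => j _; rewrite enum_valK !mxE enum_rankK_in.
Qed.

(** * Rational spans of monomials *)

Section monomials.
Variable F : numFieldType.

Definition monomial (J : finType) (x : J -> F) (a : J -> nat) : F :=
  \prod_j x j ^+ a j.

Lemma monomialD (J : finType) (x : J -> F) (a b : J -> nat) :
  monomial x (fun j => a j + b j)%N = monomial x a * monomial x b.
Proof. by rewrite /monomial -big_split; apply: eq_bigr => j _; rewrite exprD. Qed.

Lemma eq_monomial (J : finType) (x : J -> F) (a b : J -> nat) :
  a =1 b -> monomial x a = monomial x b.
Proof. by move=> ab; apply: eq_bigr => j _; rewrite ab. Qed.

(** The bound [k] applies to each exponent separately: the monomials form a box, easy to count, and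
    bounds add under products. *)
Definition rat_span (J : finType) (x : J -> F) (k : nat) (y : F) : Prop :=
  exists q : {ffun J -> 'I_k.+1} -> rat,
    y = \sum_b ratr (q b) * monomial x (fun j => b j).

Section span.
Variables (J : finType) (x : J -> F).

Lemma rat_span_monomial k (a : J -> nat) :
  (forall j, a j <= k)%N -> rat_span x k (monomial x a).
Proof.
move=> le_ak; pose b := [ffun j => inord (a j)] : {ffun J -> 'I_k.+1}.
exists (fun b' => (b' == b)%:R); rewrite (bigD1 b) //= eqxx rmorph1 mul1r.
rewrite big1 ?addr0 => [|b' /negPf->]; last by rewrite rmorph0 mul0r.
by apply: eq_monomial => j; rewrite ffunE inordK // ltnS.
Qed.

Lemma rat_span_sum k (I : finType) (f : I -> F) :
  (forall i, rat_span x k (f i)) -> rat_span x k (\sum_i f i).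
Proof.
move=> /fin_all_exists[q fE]; exists (fun b => \sum_i q i b).
rewrite (eq_bigr _ (fun i _ => fE i)) exchange_big; apply: eq_bigr => b _ /=.
by rewrite rmorph_sum mulr_suml.
Qed.

Lemma rat_spanZ k (a : rat) y : rat_span x k y -> rat_span x k (ratr a * y).
Proof.
case=> q ->; exists (fun b => a * q b); rewrite mulr_sumr.
by apply: eq_bigr => b _; rewrite rmorphM mulrA.
Qed.

Lemma rat_span0 k : rat_span x k 0.
Proof. by exists (fun=> 0); rewrite big1 // => b _; rewrite rmorph0 mul0r. Qed.

Lemma rat_spanN k y : rat_span x k y -> rat_span x k (- y).
Proof. by move=> /(rat_spanZ (-1)); rewrite rmorphN1 mulN1r. Qed.

Lemma rat_spanM k1 k2 y z :
  rat_span x k1 y -> rat_span x k2 z -> rat_span x (k1 + k2) (y * z).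
Proof.
move=> [q ->] [q' ->]; rewrite mulr_suml; apply: rat_span_sum => b.
rewrite mulr_sumr; apply: rat_span_sum => b'.
rewrite mulrACA -monomialD -mulrA; do 2!apply: rat_spanZ.
by apply: rat_span_monomial => j; rewrite leq_add // -ltnS.
Qed.

Lemma rat_span1 : rat_span x 0 1.
Proof.
suff -> : 1 = monomial x (fun=> 0%N) by exact: rat_span_monomial.
by rewrite /monomial big1.
Qed.

Lemma rat_spanX k y n : rat_span x k y -> rat_span x (k * n) (y ^+ n).
Proof.
move=> sy; elim: n => [|n IHn]; first by rewrite muln0; exact: rat_span1.
by rewrite mulnS exprS; exact: rat_spanM.
Qed.

Lemma rat_span_prod k n (f : 'I_n -> F) :
  (forall i, rat_span x k (f i)) -> rat_span x (k * n) (\prod_i f i).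
Proof.
elim: n f => [|n IHn] f sf; first by rewrite muln0 big_ord0; exact: rat_span1.
by rewrite mulnS big_ord_recl; apply: rat_spanM => //; exact: IHn.
Qed.

End span.

(* With exponents read as digits in base l+1, distinct monomials of degree at
   most l have distinct weights. As the weight is linear, each division step
   lowers it by at least one, so linearly many steps suffice (a lexicographic
   order would not give this). *)
Definition weight (l d : nat) (a : 'I_d -> nat) : nat :=
  \sum_(j < d) a j * l.+1 ^ j.

Lemma weightD l d (a b : 'I_d -> nat) :
  weight l (fun j => a j + b j)%N = (weight l a + weight l b)%N.
Proof. by rewrite /weight -big_split; apply: eq_bigr => j _ /=; rewrite mulnDl. Qed.

Lemma weight_inj l d (a b : 'I_d -> nat) :
  (forall j, a j <= l)%N -> (forall j, b j <= l)%N ->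
  weight l a = weight l b -> a =1 b.
Proof.
elim: d a b => [|d IHd] a b al bl; first by move=> _ [].
rewrite /weight !big_ord_recl !expn0 !muln1.
have shift (c : 'I_d.+1 -> nat) :
    (\sum_(i < d) c (lift ord0 i) * l.+1 ^ lift ord0 i)%N =
    (weight l (c \o lift ord0) * l.+1)%N.
  rewrite /weight big_distrl; apply: eq_bigr => i _.
  by rewrite lift0 expnSr mulnA.
rewrite !shift => eq_w.
have eq0 : a ord0 = b ord0.
  have /(congr1 (modn^~ l.+1)) := eq_w.
  by rewrite /= ![(_ ord0 + _)%N]addnC !modnMDl !modn_small // ltnS.
have eqS : a \o lift ord0 =1 b \o lift ord0.
  apply: IHd => [j|j|] //=.
  by move/eqP: eq_w; rewrite eq0 eqn_add2l eqn_pmul2r // => /eqP.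
by move=> j; case: (unliftP ord0 j) => [i|] -> //; exact: eqS.
Qed.

(** * Division by a form with leading exponent [m] *)

Section reduction.
Variables (J : finType) (t : J -> F) (l d k : nat).
Variables (x : 'I_d -> F) (c : {ffun 'I_d -> 'I_l.+1} -> F).
Variable m : {ffun 'I_d -> 'I_l.+1}.
Hypothesis c_span : forall g, rat_span t k (c g).
Hypothesis c_homo : forall g, c g != 0 -> (\sum_j g j)%N = l.
Hypothesis cm_neq0 : c m != 0.
Hypothesis m_max : forall g, c g != 0 -> g != m ->
  (weight l (fun j => g j) < weight l (fun j => m j))%N.
Hypothesis x_root : \sum_g c g * monomial x (fun j => g j) = 0.

(** The monomial of exponents [g] is not divisible by the leading one. *)
Definition reduced B (g : {ffun 'I_d -> 'I_B}) := [exists j, (g j < m j)%N].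

(** If [m] divides [a], the root equation trades [c m] times the leading factor for the other terms
    of the form. By homogeneity the total degree is kept, by [m_max] the weight drops, and induction
    on [W] applies. Each division contributes one factor [c g] to the coefficients, whence the bound
    [k * W]. *)
Lemma monomial_reduction W B (a : 'I_d -> nat) :
  (weight l a < W)%N -> (\sum_j a j <= B)%N ->
  exists Q : {ffun 'I_d -> 'I_B.+1} -> F,
  [/\ forall g, rat_span t (k * W) (Q g),
      forall g, ~~ reduced g -> Q g = 0 &
      c m ^+ W * monomial x a = \sum_g Q g * monomial x (fun j => g j)].
Proof.
elim: W a => // W IHW a; rewrite ltnS => aW aB.
have [|/existsPn mlea] := boolP [exists j, (a j < m j)%N].
  move=> ared; pose g0 := [ffun j => inord (a j)] : {ffun 'I_d -> 'I_B.+1}.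
  have g0E j : g0 j = a j :> nat.
    by rewrite ffunE inordK // ltnS (leq_trans _ aB) // (bigD1 j) //= leq_addr.
  exists (fun g => (g == g0)%:R * c m ^+ W.+1); split => [g|g|].
  - case: (g == g0); rewrite ?mul0r; last exact: rat_span0.
    by rewrite mul1r; exact: rat_spanX.
  - apply: contraNeq => /=; have [->|] := eqVneq g g0; last by rewrite mul0r eqxx.
    by move=> _; case/existsP: ared => j ltj; apply/existsP; exists j; rewrite g0E.
  - rewrite (bigD1 g0) //= eqxx mul1r big1 ?addr0 => [|g /negPf->].
      by congr (_ * _); apply: eq_monomial => j; rewrite g0E.
    by rewrite !mul0r.
have {}mlea j : (m j <= a j)%N by rewrite leqNgt; exact: mlea.
(* The value 0 in the excluded cases makes [Q] total in [g], so that finite choice applies. *)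
have step (g : {ffun 'I_d -> 'I_l.+1}) : exists Q : {ffun 'I_d -> 'I_B.+1} -> F,
  [/\ forall b, rat_span t (k * W) (Q b),
      forall b, ~~ reduced b -> Q b = 0 &
      c g != 0 -> g != m ->
      c m ^+ W * monomial x (fun j => g j + (a j - m j))%N =
      \sum_b Q b * monomial x (fun j => b j)].
  have [cg|cg] := eqVneq (c g) 0.
    by exists (fun=> 0); split => // b; exact: rat_span0.
  have [gm|gm] := eqVneq g m.
    by exists (fun=> 0); split => // b; exact: rat_span0.
  have [||Q [Q1 Q2 Q3]] := IHW (fun j => g j + (a j - m j))%N.
  - apply: leq_trans aW.
    have -> : weight l a = weight l (fun j => m j + (a j - m j))%N.
      by apply: eq_bigr => j _; rewrite subnKC.
    by rewrite !weightD ltn_add2r; exact: m_max.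
  - apply: leq_trans aB; rewrite big_split /= (c_homo cg) -[X in (X + _)%N](c_homo cm_neq0).
    by rewrite -big_split leq_sum // => j _; rewrite /= subnKC.
  - by exists Q; split.
have [Q QP] := fin_all_exists step.
exists (fun b => \sum_g (if g == m then 0 else - c g * Q g b)); split => [b|b nb|].
- apply: rat_span_sum => g; case: eqP => _; first exact: rat_span0.
  rewrite mulnS; apply: rat_spanM; first exact: rat_spanN.
  by case: (QP g).
- by rewrite big1 // => g _; case: eqP => // _; case: (QP g) => _ -> //; rewrite mulr0.
have -> : monomial x a =
    monomial x (fun j => m j) * monomial x (fun j => a j - m j)%N.
  by rewrite -monomialD; apply: eq_monomial => j; rewrite subnKC.
move/eqP: x_root; rewrite (bigD1 m) //= addr_eq0 => /eqP cmE.
rewrite exprSr mulrA -(mulrA (c m ^+ W)) cmE mulrN mulNr -mulrA mulr_suml mulr_sumr.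
rewrite -sumrN.
under [RHS]eq_bigr do rewrite mulr_suml.
rewrite exchange_big /= [LHS]big_mkcond; apply: eq_bigr => g _ /=.
have [->|gm] := eqVneq g m; first by rewrite big1 // => b _; rewrite mul0r.
under eq_bigr do rewrite mulNr mulNr -mulrA.
rewrite sumrN -mulr_sumr; congr (- _).
have [->|cg] := eqVneq (c g) 0; first by rewrite !mul0r mulr0.
case: (QP g) => _ _ /(_ cg gm) <-.
by rewrite monomialD -!mulrA mulrCA.
Qed.

(** Union bound over the coordinate [j] where divisibility fails: at most [l.+1] exponents there,
    [B] at each other coordinate. *)
Lemma card_reduced B : (0 < d)%N ->
  (#|[pred g : {ffun 'I_d -> 'I_B} | reduced g]| <= d * (l.+1 * B ^ d.-1))%N.
Proof.
move=> d0.
rewrite -sum1_card; apply: (@leq_trans (\sum_(g : {ffun 'I_d -> 'I_B}) \sum_(j < d) (g j < m j))).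
  rewrite big_mkcond; apply: leq_sum => g _; rewrite inE.
  by case: ifP => // /existsP[j ltgm]; rewrite (bigD1 j) //= ltgm.
rewrite exchange_big /= -[X in (_ <= X * _)%N]card_ord -sum_nat_const.
apply: leq_sum => j _; rewrite -big_mkcond sum1_card.
pose f (i : 'I_d) : pred 'I_B :=
  if i == j then [pred b : 'I_B | b < m j]%N else predT.
rewrite (@eq_card _ _ (mem (family f))) => [|g]; last first.
  rewrite !inE; apply/idP/familyP => [ltgm i|/(_ j)]; last by rewrite /f eqxx.
  by rewrite /f; case: eqP => // ->.
rewrite card_family foldrE big_map big_enum /= (bigD1 j) //= leq_mul //.
  rewrite /f eqxx; apply: (@leq_trans (m j)); last by rewrite ltnW.
  rewrite cardE -(size_map val) -[leqRHS](size_iota 0 (m j)).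
  apply: uniq_leq_size => [|i /mapP[b]].
    by rewrite map_inj_uniq ?enum_uniq //; exact: val_inj.
  by rewrite mem_enum inE mem_iota => ltb ->.
rewrite (eq_bigr (fun=> B)) => [|i /negPf ij]; last by rewrite /f ij card_ord.
by rewrite prod_nat_const cardC1 card_ord.
Qed.
End reduction.
End monomials.

(** * Counting estimates *)

Lemma leq_expl (a b e : nat) : (a <= b)%N -> (a ^ e <= b ^ e)%N.
Proof. by case: e => // e; rewrite leq_exp2r. Qed.

(** In [n], the left side has degree m + (d - 1)N and the right side dN, which is larger since m <
    N. *)
Lemma polynomial_growth (a b c d m N : nat) : (0 < d)%N -> (m < N)%N ->
  exists n, ((a * n + b).+1 ^ m * (c * (n * d).+1 ^ d.-1) ^ N < (n ^ d) ^ N)%N.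
Proof.
move=> d0 mN; pose K := ((a + b).+1 ^ m * (c * d.+1 ^ d.-1) ^ N)%N.
(* [K] collects the constants left after [n] is factored out. The choice K + 2 exceeds [K], to
   absorb it, and 1, to compare powers by exponents. *)
exists K.+2; set n := K.+2.
have le1 : ((a * n + b).+1 <= n * (a + b).+1)%N by rewrite /n; nia.
have le2 : ((n * d).+1 <= n * d.+1)%N by rewrite /n; nia.
apply: (@leq_ltn_trans (K * n ^ (m + d.-1 * N))).
  rewrite expnD expnM mulnA (mulnAC K) /K.
  apply: (@leq_trans ((n * (a + b).+1) ^ m * (c * (n * d.+1) ^ d.-1) ^ N)).
    by rewrite leq_mul // leq_expl // leq_mul // leq_expl.
  by apply: eq_leq; rewrite !expnMn -!expnM; ring.
rewrite -expnM; apply: (@leq_trans (n ^ (m + d.-1 * N).+1)).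
  by rewrite expnS ltn_pmul2r ?expn_gt0 // ltnW.
by rewrite leq_exp2l // -[in ltnRHS](prednK d0) mulSn ltn_add2r.
Qed.

Lemma prod_count (F : comNzRingType) (J : finType) (x : J -> F) (s : seq J) :
  \prod_(j <- s) x j = \prod_j x j ^+ count_mem j s.
Proof.
elim: s => [|i s IHs]; first by rewrite big_nil big1.
rewrite big_cons IHs /= [RHS](eq_bigr (fun j => x j ^+ (i == j) * x j ^+ count_mem j s)).
  rewrite big_split /=; congr (_ * _); rewrite (bigD1 i) //= eqxx expr1.
  by rewrite big1 ?mulr1 // => j /negPf; rewrite eq_sym => ->.
by move=> j _; rewrite exprD.
Qed.

(** * Forms vanishing at algebraically independent points *)

Section forms.
Variable F : numFieldType.

(** Joint independence over the rationals of all Nd coordinates. Exponents are grouped by point,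
    since division is carried out at each point separately. *)
Definition alg_indep (N d : nat) (x : 'I_N -> 'I_d -> F) : Prop :=
  forall n (y : {ffun 'I_N -> {ffun 'I_d -> 'I_n}} -> rat),
    \sum_a ratr (y a) * \prod_i monomial (x i) (fun j => a i j) = 0 ->
  forall a, y a = 0.

(** Dimension count: up to the factor [c m ^+ (W * N)], the n^(dN) monomials in the coordinates lie
    in the rational span of fewer products of a monomial in [t] with reduced monomials at the
    points. *)
Lemma alg_indep_lead_coef_eq0 (J : finType) (t : J -> F) (N d l : nat)
    (x : 'I_N -> 'I_d -> F) (c : {ffun 'I_d -> 'I_l.+1} -> F)
    (m : {ffun 'I_d -> 'I_l.+1}) :
  (0 < d)%N -> (#|J| < N)%N -> alg_indep x ->
  (forall g, rat_span t l (c g)) ->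
  (forall g, c g != 0 -> (\sum_j g j)%N = l) ->
  (forall g, c g != 0 -> g != m ->
    (weight l (fun j => g j) < weight l (fun j => m j))%N) ->
  (forall i, \sum_g c g * monomial (x i) (fun j => g j) = 0) ->
  c m = 0.
Proof.
move=> d0 ltJN xfree c_span c_homo m_max x_root.
apply/eqP/negPn/negP => cm_neq0.
(* The weight of the all-ones exponent: exponents below [n] have weight at most [w * n], hence less
   than [W], and total degree at most [B]. *)
pose w := (\sum_(j < d) l.+1 ^ j)%N.
(* With [W = w * n + 1], the bound [l * W * N] on the exponents in [t] equals
   [l * w * N * n + l * N]. *)
have [n] := polynomial_growth (l * w * N) (l * N) (d * l.+1) d0 ltJN.
set W := (w * n).+1; set B := (n * d)%N => growth.
have step (i : 'I_N) (a : {ffun 'I_d -> 'I_n}) :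
    exists Q : {ffun 'I_d -> 'I_B.+1} -> F,
    [/\ forall g, rat_span t (l * W) (Q g),
        forall g, ~~ reduced m g -> Q g = 0 &
        c m ^+ W * monomial (x i) (fun j => a j) =
        \sum_g Q g * monomial (x i) (fun j => g j)].
  apply: monomial_reduction => //.
  - rewrite ltnS /weight /w big_distrl leq_sum // => j _.
    by rewrite mulnC leq_mul2l ltnW ?orbT.
  - rewrite /B mulnC -[X in (_ <= X * _)%N]card_ord -sum_nat_const.
    by rewrite leq_sum // => j _; rewrite ltnW.
have [Q QP] := fin_all_exists (fun i => fin_all_exists (step i)).
have Qspan (a : {ffun 'I_N -> {ffun 'I_d -> 'I_n}})
    (f : {ffun 'I_N -> {ffun 'I_d -> 'I_B.+1}}) :
    rat_span t (l * W * N) (\prod_i Q i (a i) (f i)).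
  by apply: rat_span_prod => i; case: (QP i (a i)).
have [q qE] := fin_all_exists (fun a => fin_all_exists (Qspan a)).
pose S := [pred bf : {ffun J -> 'I_(l * W * N).+1} *
                     {ffun 'I_N -> {ffun 'I_d -> 'I_B.+1}}
          | bf.2 \in ffun_on [pred g | reduced m g]].
have [|y [a0 ya0] yM] :=
  @linear_dependence _ {ffun 'I_N -> {ffun 'I_d -> 'I_n}} _ S
    (fun a bf => q a bf.2 bf.1).
  rewrite !card_ffun !card_ord; apply: leq_ltn_trans growth.
  rewrite (@eq_card _ _ [predX predT & ffun_on [pred g | reduced m g]]) // cardX.
  rewrite card_ffun_on card_ord card_ffun card_ord.
  rewrite leq_mul //; last by apply: leq_expl; rewrite -mulnA; exact: card_reduced.
  by apply: leq_expl; rewrite ltnS /W -addn1; apply: eq_leq; ring.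
move/eqP: ya0; apply; apply: xfree.
(* Each of the [N] points receives one factor [c m ^+ W], which pays for its reduction. *)
apply: (mulfI (expf_neq0 (W * N) cm_neq0)); rewrite mulr0 mulr_sumr.
transitivity (\sum_a \sum_(f : {ffun 'I_N -> {ffun 'I_d -> 'I_B.+1}})
   ratr (y a) * (\prod_i Q i (a i) (f i)) * \prod_i monomial (x i) (fun j => f i j)).
  apply: eq_bigr => a _; rewrite mulrCA exprM -[X in _ ^+ X]card_ord -prodr_const -big_split /=.
  rewrite (eq_bigr (fun i => \sum_g Q i (a i) g * monomial (x i) (fun j => g j))); last first.
    by move=> i _; case: (QP i (a i)).
  rewrite bigA_distr_bigA mulr_sumr; apply: eq_bigr => f _.
  by rewrite big_split /= mulrA.
rewrite exchange_big big1 // => f _; rewrite -mulr_suml.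
(* A family with a member that is not reduced has coefficient zero; for the others, [yM] cancels
   every monomial in [t]. *)
have [fred|/ffun_onP fred] := boolP (f \in ffun_on [pred g | reduced m g]); last first.
  have [/existsP[i nred]|/existsPn fr] := boolP [exists i, ~~ reduced m (f i)]; last first.
    by case: fred => i; rewrite inE -[reduced _ _]negbK; exact: fr.
  rewrite big1 ?mul0r // => a _; rewrite (bigD1 i) //= (_ : Q i _ _ = 0) ?mul0r ?mulr0 //.
  by case: (QP i (a i)) => _ ->.
rewrite (eq_bigr (fun a => \sum_b ratr (y a * q a f b) * monomial t (fun j => b j))).
  rewrite exchange_big big1 ?mul0r // => b _.
  by rewrite -mulr_suml -rmorph_sum (yM (b, f)) // rmorph0 mul0r.
move=> a _; rewrite qE mulr_sumr; apply: eq_bigr => b _.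
by rewrite rmorphM mulrA.
Qed.

(** The coefficients of the form attached to [T] are rational polynomials in the |A|d numbers
    [u a j]. If [T] were nonzero, the form would have a leading coefficient, which the dimension
    count forces to vanish. *)
Theorem alg_indep_form_eq0 (N d l : nat) (A : finType) (x : 'I_N -> 'I_d -> F)
    (s : A -> rat) (u : A -> 'I_d -> F) :
  (0 < d)%N -> (#|A| * d < N)%N -> alg_indep x ->
  let T (I : l.-tuple 'I_d) := \sum_a ratr (s a) * \prod_k u a (tnth I k) in
  (forall i, \sum_I T I * \prod_k x i (tnth I k) = 0) ->
  forall I, T I = 0.
Proof.
move=> d0 ltAdN xfree T x_root I0; apply/eqP/negPn/negP => TI0.
(* The content of [I]: both [T] and the monomial at [I] depend only on it. *)
pose g (I : l.-tuple 'I_d) := [ffun j => inord (count_mem j I)] : {ffun 'I_d -> 'I_l.+1}.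
have gE I j : g I j = count_mem j I :> nat.
  by rewrite ffunE inordK // ltnS -[leqRHS](size_tuple I) count_size.
have prodE (z : 'I_d -> F) I :
    \prod_k z (tnth I k) = monomial z (fun j => g I j).
  rewrite -(big_tuple _ _ I xpredT z) prod_count.
  by apply: eq_bigr => j _; rewrite gE.
pose t (h : {ffun 'I_d -> 'I_l.+1}) := \sum_a ratr (s a) * monomial (u a) (fun j => h j).
have TE I : T I = t (g I) by apply: eq_bigr => a _; rewrite prodE.
(* The cardinal is a multinomial coefficient, nonzero in characteristic zero when [h] is a
   content. *)
pose c h := #|[pred I | g I == h]|%:R * t h.
have cg I : t (g I) != 0 -> c (g I) != 0.
  by move=> ?; rewrite mulf_neq0 // pnatr_eq0 -lt0n; apply/card_gt0P; exists I; rewrite inE.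
have c_type h : c h != 0 -> exists I, g I = h.
  rewrite /c; case: (pickP [pred I | g I == h]) => [I /eqP <-|/eq_card0 ->]; first by exists I.
  by rewrite mul0r eqxx.
have {TI0} cI0 : c (g I0) != 0 by rewrite cg -?TE.
case: (@arg_maxnP _ (g I0) (fun h => c h != 0) (fun h => weight l (fun j => h j)) cI0).
move=> m /eqP cm m_max; apply: cm.
pose v (p : A * 'I_d) := u p.1 p.2.
apply: (@alg_indep_lead_coef_eq0 _ v N d l x) => //.
- by rewrite card_prod card_ord.
- move=> h; rewrite /c -(ratr_nat F); apply: rat_spanZ; apply: rat_span_sum => a.
  apply: rat_spanZ.
  have -> : monomial (u a) (fun j => h j) =
      monomial v (fun p => if p.1 == a then h p.2 : nat else 0%N).
    rewrite /monomial -(pair_bigA _ (fun b j =>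
      v (b, j) ^+ (if b == a then h j : nat else 0%N))) /=.
    rewrite (bigD1 a) //= eqxx [X in _ * X]big1 ?mulr1 // => b /negPf ->.
    by rewrite big1.
  by apply: rat_span_monomial => p; case: ifP => // _; rewrite -ltnS.
- move=> h /c_type[I <-]; under eq_bigr do rewrite gE.
  rewrite -[RHS](size_tuple I); elim: (tval I) => [|i r IHr]; first by rewrite big1.
  by rewrite /= big_split IHr /= (bigD1 i) //= eqxx big1 // => j /negPf; rewrite eq_sym => ->.
- move=> h ch hm; rewrite ltn_neqAle (m_max _ ch : (_ <= _)%N) andbT.
  apply: contraNneq hm => /weight_inj hm; apply/eqP/ffunP => j; apply/val_inj.
  by apply: hm => i; rewrite -ltnS.
- move=> i; rewrite -[RHS](x_root i) (partition_big g xpredT) //=.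
  apply: eq_bigr => h _; rewrite /c -mulrA mulr_natl -sumr_const.
  by apply: eq_big => [I|I]; rewrite ?inE // => /eqP <-; rewrite TE prodE.
Qed.
End forms.

(** * Almost sure algebraic independence of the coordinates *)

Lemma measurable_forall d (T : measurableType d) (I : finType) (A : I -> set T) :
  (forall i, measurable (A i)) -> measurable [set w | forall i, A i w].
Proof.
move=> mA; rewrite (_ : [set w | _] = \bigcap_(i in [set: I]) A i).
  by apply: fin_bigcap_measurable => //; exact: finite_finset.
by apply/seteqP; split=> [w Aw i _|w Aw i]; exact: Aw.
Qed.

Lemma measurable_sum_cond d (T : measurableType d) (R : realType) (I : finType)
    (Q : pred I) (h : I -> T -> R) :
  (forall i, measurable_fun setT (h i)) ->
  measurable_fun setT (fun x => \sum_(i | Q i) h i x).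
Proof.
move=> mh.
rewrite (_ : (fun x => _) = fun x => \sum_i if Q i then h i x else 0).
  by apply: measurable_sum => i; case: (Q i) => //; exact: measurable_cst.
by apply/funext => x; rewrite big_mkcond.
Qed.

Section null_sections.
Context d (Omega : measurableType d) (R : realType) (P : probability Omega R).
Variable D : probability R R.

(** Independence makes the joint law of [U] and [z] a product measure, and integrating the null
    sections gives zero. *)
Lemma indep_null_sections d' (T : measurableType d') (U : {mfun Omega >-> T})
    (z : {mfun Omega >-> R}) (E : set (T * R)) :
  (forall A B, measurable A -> measurable B ->
    P (U @^-1` A `&` z @^-1` B) = (P (U @^-1` A) * D B)%E) ->
  measurable E -> (forall t, D (xsection E t) = 0) ->
  P.-negligible [set w | E (U w, z w)].
Proof.
move=> indepUz mE nullE.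
have mUz : measurable_fun setT (fun w => (U w, z w)) by exact: measurable_fun_pair.
pose Uz : {mfun Omega >-> (T * R)%type} := mfun_Sub (mem_set mUz).
exists (Uz @^-1` E); split => //.
  by rewrite -[X in measurable X]setTI; exact: measurable_funPT.
rewrite -[LHS]/(distribution P Uz E).
rewrite -(@product_measure_unique _ _ _ _ _ (distribution P U) D _ _ _ mE) //.
by rewrite /product_measure1 integral0_eq // => t _; exact: nullE.
Qed.

Section coordinates.
Variables (I : finType) (Z : I -> {mfun Omega >-> R}).
Hypothesis Z_iid : forall B : I -> set R, (forall i, measurable (B i)) ->
  P [set w | forall i, B i (Z i w)] = (\prod_i D (B i))%E.

(* The sigma-algebra of the coordinates other than k is put on Omega itself, so
   that the Fubini argument needs no space of truncated families. *)
Definition cylinder_off (k : I) : set (set Omega) :=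
  [set A | exists2 B : I -> set R, forall i, measurable (B i) &
           A = [set w | forall i, i != k -> B i (Z i w)]].

Lemma measurable_cylinder_off k : cylinder_off k `<=` measurable.
Proof.
move=> _ [B mB ->].
apply: (@measurable_forall _ _ _ (fun i => [set w | i != k -> B i (Z i w)])) => i.
have [->|ik] := eqVneq i k.
  by rewrite (_ : mkset _ = setT) //; apply/seteqP; split.
rewrite (_ : mkset _ = Z i @^-1` B i).
  by rewrite -[X in measurable X]setTI; exact: measurable_funPT.
by apply/seteqP; split=> [w /(_ isT)|w Bw _].
Qed.

(** The cylinders form a pi-system, and both sides are finite measures in [A] that agree on it. *)
Lemma cylinder_off_indep k (A : set Omega) (B : set R) :
  <<s cylinder_off k >> A -> measurable B ->
  P (A `&` Z k @^-1` B) = (P A * D B)%E.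
Proof.
move=> sA mB.
have mzB : measurable (Z k @^-1` B).
  by rewrite -[X in measurable X]setTI; exact: measurable_funPT.
(* [mscale] takes a nonnegative real factor, and [D B] is finite. *)
have [c cE] : exists c : {nonneg R}, D B = c%:num%:E.
  have fB : D B \is a fin_num by exact: fin_num_measure.
  have ge0 : 0 <= fine (D B) by exact: fine_ge0.
  by exists (NngNum ge0); rewrite /= fineK.
rewrite cE muleC; apply: (g_sigma_algebra_measure_unique (cylinder_off k) _
  (fun=> setT) _ _ (mrestr P mzB) (mscale c P)) => //.
- exact: measurable_cylinder_off.
- by move=> _; exists (fun=> setT) => //; apply/seteqP; split.
- by rewrite bigcup_const //; exists 0%N.
- move=> _ _ [B1 mB1 ->] [B2 mB2 ->]; exists (fun i => B1 i `&` B2 i).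
    by move=> i; exact: measurableI.
  apply/seteqP; split=> [w [B1w B2w] i ik|w Bw]; first by split; [exact: B1w|exact: B2w].
  by split=> i /Bw[].
- move=> _ [C mC ->]; rewrite /mrestr /mscale -cE /=.
  (* Coordinate [k] of the cylinder is filled with [B] for the joint event and with [setT] for the
     cylinder itself. *)
  pose C' B0 i := if i == k then B0 else C i.
  have PC' B0 : measurable B0 -> P [set w | forall i, C' B0 i (Z i w)] =
      (D B0 * \prod_(i | i != k) D (C i))%E.
    move=> mB0; rewrite Z_iid => [|i]; last by rewrite /C'; case: eqP.
    rewrite (bigD1 k) //= /C' eqxx; congr (_ * _)%E.
    by apply: eq_bigr => i /negPf ->.
  transitivity (P [set w | forall i, C' B i (Z i w)]).
    congr (P _); apply/seteqP; split=> [w [Cw Bw] i|w Cw].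
      by rewrite /C'; case: eqP => [->//|/eqP]; exact: Cw.
    split=> [i ik|]; first by have := Cw i; rewrite /C' (negPf ik).
    by have := Cw k; rewrite /C' eqxx.
  rewrite PC' // cE; congr (_ * _)%E.
  transitivity (P [set w | forall i, C' setT i (Z i w)]).
    by rewrite PC' ?probability_setT ?mul1e.
  congr (P _); apply/seteqP; split=> [w Cw i ik|w Cw i].
    by have := Cw i; rewrite /C' (negPf ik).
  by rewrite /C'; have [_|ik] := eqVneq i k => //; exact: Cw.
- by move=> _; rewrite /mrestr (le_lt_trans (probability_le1 _ _)) ?ltry //; rewrite setTI.
Qed.

Hypothesis D_atomless : forall r : R, D [set r] = 0.

Lemma atomless_roots (p : {poly R}) (A : set R) :
  measurable A -> p != 0 -> A `<=` [set r | root p r] -> D A = 0.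
Proof.
move=> mA p0 Ap.
have /finite_seqP[s sE] : finite_set [set r | root p r].
  apply: contrapT => /(@infinite_set_fset _ _ (size p))[X Xp leX].
  suff: (size (finmap.enum_fset X) < size p)%N by rewrite ltnNge leX.
  apply: max_poly_roots p0 _ (finmap.fset_uniq X).
  by apply/allP => r rX; exact: Xp.
apply/negligibleP => //; apply: negligibleS Ap _; rewrite sE.
elim: s {sE} => [|r s IHs].
  by rewrite set_nil; exact: negligible_set0.
rewrite (_ : [set` r :: s] = [set r] `|` [set` s]).
  by apply: negligibleU => //; apply/negligibleP => //; exact: D_atomless.
by apply/seteqP; split=> x /=; rewrite inE => /predU1P.
Qed.

Lemma measurable_coordinate_off k i : i != k ->
  measurable_fun [set: g_sigma_algebraType (cylinder_off k)]
    (Z i : g_sigma_algebraType (cylinder_off k) -> R).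
Proof.
move=> ik _ B mB; rewrite setTI; apply: sub_sigma_algebra.
exists (fun j => if j == i then B else setT); first by move=> j; case: ifP.
apply/seteqP; split=> [w Bw j _ /=|w /(_ _ ik)]; last by rewrite eqxx.
by case: eqP => // ->.
Qed.

Variables (E : finType) (e : E -> I -> nat) (c : E -> R).

Definition agree_off (s : seq I) (a b : E) :=
  [forall i, (i \notin s) ==> (e a i == e b i)].

Lemma agree_off_cons k s a b : k \notin s ->
  agree_off s a b = (e a k == e b k) && agree_off (k :: s) a b.
Proof.
move=> ks; apply/forallP/andP => [ab|[abk /forallP ab] i].
  split; first by have := ab k; rewrite ks.
  by apply/forallP => i; apply/implyP; rewrite inE negb_or => /andP[_]; exact/implyP.
apply/implyP => si; have [->//|ik] := eqVneq i k.
by have := ab i; rewrite inE negb_or ik si.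
Qed.

(* The coefficient of the monomial of exponents [e b] in the variables outside s,
   evaluated in the variables of s. *)
Definition partial_eval (s : seq I) (b : E) (w : Omega) : R :=
  \sum_(a | agree_off s a b) c a * \prod_(i <- s) Z i w ^+ e a i.

(** With the other coordinates fixed, the new value is a polynomial in [Z k] whose coefficient of
    degree [e b k] is the old value. If that is nonzero, the roots are finitely many, hence null for
    [D], and [Z k] is independent of the rest. *)
Lemma partial_eval_step k s b : k \notin s ->
  {ae P, forall w, partial_eval s b w != 0 -> partial_eval (k :: s) b w != 0}.
Proof.
move=> ks; pose T := g_sigma_algebraType (cylinder_off k).
have mU : measurable_fun setT (id : Omega -> T).
  move=> _ A sA; rewrite setTI; apply: smallest_sub sA.
    exact: sigma_algebra_measurable.
  exact: measurable_cylinder_off.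
(* The identity onto the coarser sigma-algebra stands for all coordinates but [k]. *)
pose U : {mfun Omega >-> T} := mfun_Sub (mem_set mU).
pose val_at (a : E) (p : T * R) : R :=
  c a * (\prod_(i <- s) Z i p.1 ^+ e a i) * p.2 ^+ e a k.
pose f (p : T * R) := partial_eval s b p.1.
pose g (p : T * R) := \sum_(a | agree_off (k :: s) a b) val_at a p.
have mprod a : measurable_fun setT (fun p : T * R => \prod_(i <- s) Z i p.1 ^+ e a i).
  apply: measurable_prod => i si; apply: measurable_funX.
  have ik : i != k by apply: contraNneq ks => <-.
  exact: (measurableT_comp (measurable_coordinate_off ik) measurable_fst).
have mf : measurable_fun setT f.
  by apply: measurable_sum_cond => a; exact: measurable_funM.
have mg : measurable_fun setT g.
  apply: measurable_sum_cond => a; apply: measurable_funM.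
    exact: measurable_funM.
  exact: measurable_funX.
pose N : set (T * R) := (f @^-1` (~` [set 0])) `&` (g @^-1` [set 0]).
have mN : measurable N.
  apply: measurableI.
    by rewrite -[X in measurable X]setTI; apply: mf => //; exact: measurableC.
  by rewrite -[X in measurable X]setTI; exact: mg.
have nullN : P.-negligible [set w | N (U w, Z k w)].
  apply: indep_null_sections => // [A B mA mB|t].
    exact: cylinder_off_indep.
  have [ft0|ft0] := eqVneq (partial_eval s b t) 0.
    rewrite (_ : xsection N t = set0) ?measure0 //.
    by apply/seteqP; split=> // r; rewrite /xsection /= inE => -[].
  pose p := \sum_(a | agree_off (k :: s) a b)
    (c a * \prod_(i <- s) Z i t ^+ e a i) *: 'X^(e a k).
  apply: (@atomless_roots p); first exact: measurable_xsection.
    apply: contraNneq ft0 => /(congr1 (fun q : {poly R} => q`_(e b k))).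
    rewrite coef0 coef_sum => coef0p; apply/eqP; rewrite -[RHS]coef0p /partial_eval.
    rewrite (eq_bigl _ _ (fun a => agree_off_cons a b ks)) big_mkcondl.
    apply: eq_bigr => a _; rewrite coefZ coefXn eq_sym.
    by case: eqP => _; rewrite ?mulr1 ?mulr0.
  move=> r; rewrite /xsection /= inE => -[_ gr].
  rewrite rootE horner_sum; apply/eqP; rewrite -[RHS]gr; apply: eq_bigr => a _.
  by rewrite hornerZ hornerXn.
apply: negligibleS nullN => w /= /not_implyP[f0 g0]; split; first exact/eqP.
move/negP: g0; rewrite negbK => /eqP g0; rewrite /= -[RHS]g0; apply: eq_bigr => a _.
by rewrite /val_at big_cons /= mulrCA mulrC.
Qed.

(** Variables are evaluated one at a time: with none, injectivity of [e] leaves the single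
    coefficient [c a0]; with all, the sum is the whole polynomial. *)
Lemma polynomial_neq0_ae (a0 : E) :
  (forall a b, e a =1 e b -> a = b) -> c a0 != 0 ->
  {ae P, forall w, \sum_a c a * \prod_i Z i w ^+ e a i != 0}.
Proof.
move=> e_inj ca0.
have main s : uniq s -> {ae P, forall w, exists b, partial_eval s b w != 0}.
  elim: s => [_|k s IHs /= /andP[ks us]].
    apply: aeW => w; exists a0; rewrite /partial_eval (big_pred1 a0) ?big_nil ?mulr1 // => a.
    apply/forallP/eqP => [aa0|-> i]; last by rewrite eqxx.
    by apply: e_inj => i; have /eqP := aa0 i.
  have step : {ae P, forall w, forall b,
      partial_eval s b w != 0 -> partial_eval (k :: s) b w != 0}.
    by apply: filter_forall => b; exact: partial_eval_step.
  move: step (IHs us); apply: filterS2 => w {}step [b fb].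
  by exists b; exact: step.
apply: filterS (main _ (enum_uniq I)) => w [b].
rewrite /partial_eval; congr (_ != _); apply: eq_big => [a|a _].
  by apply/forallP => i; rewrite mem_enum.
by rewrite big_enum.
Qed.

End coordinates.
End null_sections.

Lemma density_atomless (R : realType) (D : probability R R) (f : R -> R) :
  has_density D f -> forall r, D [set r] = 0.
Proof. by case=> _ _ DE r; rewrite DE // integral_set1. Qed.

(** Each nonzero rational polynomial excludes a null set, and there are countably many of them. *)
Lemma alg_indep_ae (R : realType) (N d : nat) (D : probability R R)
    (disp : measure_display) (Omega : measurableType disp)
    (P : probability Omega R) (X : 'I_N -> {RV P >-> d.-tuple R}) :
  (forall r, D [set r] = 0) ->
  (forall i, is_power_measure D (distribution P (X i))) ->
  mutually_independent X ->
  {ae P, forall w, alg_indep (fun i j => tnth (X i w) j)}.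
Proof.
move=> D_atomless hX hind.
have mZ (p : 'I_N * 'I_d) : measurable_fun setT (fun w => tnth (X p.1 w) p.2).
  exact: (measurableT_comp (@measurable_tnth _ _ _ p.2) (@measurable_funPT _ _ _ _ (X p.1))).
pose Z p : {mfun Omega >-> R} := mfun_Sub (mem_set (mZ p)).
have Z_iid (B : 'I_N * 'I_d -> set R) : (forall p, measurable (B p)) ->
    P [set w | forall p, B p (Z p w)] = (\prod_p D (B p))%E.
  move=> mB; pose A i : set (d.-tuple R) := [set x | forall j, B (i, j) (tnth x j)].
  transitivity (P [set w | forall i, A i (X i w)]).
    by congr (P _); apply/seteqP; split=> [w Bw i j|w Aw [i j]]; [exact: (Bw (i, j))|exact: Aw].
  rewrite hind => [|i]; last first.
    apply: (@measurable_forall _ _ _ (fun j => [set x : d.-tuple R | B (i, j) (tnth x j)])) => j.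
    by rewrite -[X in measurable X]setTI; exact: measurable_tnth.
  transitivity (\prod_i \prod_j D (B (i, j)))%E.
    by apply: eq_bigr => i _; exact: (hX i (fun j => B (i, j))).
  by rewrite pair_bigA; apply: eq_bigr => -[].
(* Finite functions with rational values are countable, so [unpickle] enumerates all polynomials
   with exponents below [n]. *)
suff indep_n n : {ae P, forall w, forall m,
    if unpickle m is Some y then
      forall a, (y : {ffun {ffun 'I_N -> {ffun 'I_d -> 'I_n}} -> rat}) a != 0 ->
      \sum_b ratr (y b) * \prod_p Z p w ^+ b p.1 p.2 != 0
    else True}.
  apply: filterS (ae_foralln indep_n) => w indep n y sum0 a.
  apply/eqP/negPn/negP => ya; have := indep n (pickle (finfun y)).
  rewrite pickleK => /(_ a); rewrite ffunE => /(_ ya)/eqP; apply.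
  rewrite -[RHS]sum0; apply: eq_bigr => b _; rewrite ffunE; congr (_ * _).
  by rewrite /monomial pair_bigA.
apply: ae_foralln => m; case: (unpickle m) => [y|]; last exact: aeW.
apply: filter_forall => a; have [ya|ya] := boolP (y a == 0).
  by apply: aeW => w /negP.
have := @polynomial_neq0_ae _ _ _ P D _ Z Z_iid D_atomless _
  (fun (b : {ffun 'I_N -> {ffun 'I_d -> 'I_n}}) p => b p.1 p.2) (fun b => ratr (y b)) a.
move=> /(_ _ _)/(filterS _); apply => //.
- move=> b b' bb'; apply/ffunP => i; apply/ffunP => j; apply/val_inj.
  exact: (bb' (i, j)).
- by rewrite fmorph_eq0.
Qed.

(** * Symmetric rank and recovery *)

Section tensor_lemmas.
Variables (R : realType) (l d : nat).
Implicit Types T : tensor R l d.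

Lemma sym_rank_decomposition r T : (sym_rank T <= r%:R%:E)%E ->
  exists2 s, (s <= r)%N & sym_decomposition s T.
Proof.
(* An infimum strictly below r + 1 has an actual element below r + 1. *)
move=> Tr; have : (sym_rank T < r.+1%:R%:E)%E.
  by apply: le_lt_trans Tr _; rewrite lte_fin ltr_nat.
move=> /ereal_inf_lt[_ [s [_ sT] <-]]; rewrite lte_fin ltr_nat ltnS => sr.
by exists s.
Qed.

(* Over the reals a scalar is, up to sign, an l-th power, so each term of a
   decomposition depends on d parameters only. *)
Lemma sym_decomposition_signed s T : (0 < l)%N -> sym_decomposition s T ->
  exists (e : 'I_s -> rat) (u : 'I_s -> 'I_d -> R),
    forall I, T I = \sum_(i < s) ratr (e i) * \prod_(k < l) u i (tnth I k).
Proof.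
move=> l0 [lam [v TE]].
exists (fun i => if 0 <= lam i then 1 else -1).
exists (fun i j => `|lam i| `^ l%:R^-1 * tnth (v i) j) => I.
rewrite TE; apply: eq_bigr => i _; rewrite ffunE big_split /= mulrA; congr (_ * _).
rewrite prodr_const card_ord -powR_mulrn ?powR_ge0 // -powRrM mulVf ?pnatr_eq0 -?lt0n //.
rewrite powRr1 //; case: ger0P => lam0; first by rewrite rmorph1 mul1r.
by rewrite rmorphN1 mulN1r opprK.
Qed.

(** The difference is a signed sum of s + s' powers, a form in (s + s')d parameters vanishing at all
    the points. *)
Lemma low_rank_injective N s s' (x : 'I_N -> d.-tuple R) T T' :
  (0 < l)%N -> (0 < d)%N -> ((s + s') * d < N)%N ->
  alg_indep (fun i j => tnth (x i) j) ->
  sym_decomposition s T -> sym_decomposition s' T' ->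
  (forall i, tensor_dot T (tensor_pow l (x i)) = tensor_dot T' (tensor_pow l (x i))) ->
  T = T'.
Proof.
move=> l0 d0 ltN xfree /(sym_decomposition_signed l0)[e [u TE]].
move=> /(sym_decomposition_signed l0)[e' [u' TE']] dotE.
pose E (a : 'I_s + 'I_s') := match a with inl i => e i | inr i => - e' i end.
pose U (a : 'I_s + 'I_s') := match a with inl i => u i | inr i => u' i end.
have DE I : T I - T' I = \sum_a ratr (E a) * \prod_k U a (tnth I k).
  rewrite big_sumType /= TE TE' -sumrN; congr (_ + _).
  by apply: eq_bigr => i _; rewrite rmorphN mulNr.
apply/ffunP => I; apply/eqP; rewrite -subr_eq0 DE; apply/eqP.
apply: (alg_indep_form_eq0 d0 _ xfree); first by rewrite card_sum !card_ord.
move=> i; transitivity (tensor_dot T (tensor_pow l (x i)) -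
                       tensor_dot T' (tensor_pow l (x i))).
  by rewrite -sumrB; apply: eq_bigr => I' _; rewrite -DE mulrBl ffunE.
by rewrite dotE subrr.
Qed.

End tensor_lemmas.

Theorem theorem2p1 (R : realType) (l d r N : nat)
    (hl : (0 < l)%N) (hd : (0 < d)%N) (hr : (0 < r)%N) (hN : (0 < N)%N)
    (D : probability R R) (hD : log_concave D)
    (disp : measure_display) (Omega : measurableType disp)
    (P : probability Omega R)
    (X : 'I_N -> {RV P >-> d.-tuple R})
    (hX : forall i, is_power_measure D (distribution P (X i)))
    (hind : mutually_independent X)
    (C : R) (hC : 2 * l%:R ^+ 2 < C) (hNC : C * r%:R * d%:R <= N%:R) :
  {ae P, forall w, forall Tstar : tensor R l d,
    (sym_rank Tstar <= r%:R%:E)%E ->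
    let x i := X i w in
    let Y i := tensor_dot Tstar (tensor_pow l (x i)) in
    rank_minimizers x Y = [set Tstar]}.
Proof.
(* Since l >= 1, 2rd <= 2 l^2 rd < Crd <= N. *)
have ltN : ((r + r) * d < N)%N.
  rewrite -(ltr_nat R); apply: lt_le_trans hNC.
  rewrite natrM ltr_pM2r ?ltr0n // addnn -muln2 natrM mulrC ltr_pM2r ?ltr0n //.
  apply: le_lt_trans hC; rewrite -[leLHS]mulr1 ler_pM2l ?ltr0n //.
  by rewrite exprn_ege1 // ler1n.
have [f /density_atomless D_atomless _] := hD.
apply: filterS (alg_indep_ae D_atomless hX hind) => w xfree Tstar Tr /=.
have uniq_feasible T : (sym_rank T <= r%:R%:E)%E ->
    feasible (X^~ w) (fun i => tensor_dot Tstar (tensor_pow l (X i w))) T -> T = Tstar.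
  move=> /sym_rank_decomposition[s sr sT] fT.
  have [s' s'r sT'] := sym_rank_decomposition Tr.
  apply: (low_rank_injective hl hd _ xfree sT sT') => //.
  by apply: leq_ltn_trans ltN; rewrite leq_mul2r leq_add ?orbT.
(* A minimizer has rank at most that of [Tstar], and so would any feasible tensor beating [Tstar]:
   both fall under [uniq_feasible]. *)
apply/seteqP; split=> [T [fT minT] | _ ->].
  by apply: uniq_feasible => //; apply: le_trans Tr; exact: minT.
split=> // T fT; rewrite leNgt; apply/negP => ltT.
by have := ltT; rewrite (uniq_feasible T) ?ltxx // (le_trans (ltW ltT)).
Qed.
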